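(* Let $\mathsf{tr}'$ be any (correct) translation from mental programs to BDDs, i.e. a map assigning to each mental program $\pi$ over a finite ordered vocabulary $V$ a BDD $\mathsf{tr}'(\pi)$ over $V\cup V'$ such that for all $s,t\subseteq V$, $s\xrightarrow{\pi}t$ iff $s\cup t'\vDash\mathsf{tr}'(\pi)$. Then there exist mental programs $\pi$ such that the size of $\mathsf{tr}'(\pi)$ is exponential in $|\pi|$: there are vocabularies $V_n$ and mental programs $\pi_n$ over $V_n$ ($n\ge1$) with $|\pi_n|\to\infty$ and a constant $c>0$ such that $\mathsf{tr}'(\pi_n)$ has at least $2^{c|\pi_n|}$ nodes.
   Context: Mental programs over a finite vocabulary $V$: $\pi::=p\leftarrow\top\mid p\leftarrow\bot\mid\beta?\mid\pi\cup\pi\mid\pi;\pi\mid\pi\cap\pi$ ($p\in V$, $\beta$ a Boolean formula over $V$, built from $\top,\bot$, atoms, $\neg,\land$). Length: $|p\leftarrow\top|=|p\leftarrow\bot|=1$, $|\beta?|=|\beta|$ (formula length: atoms and constants 1, each connective adds 1), $|\pi_1\cup\pi_2|=|\pi_1;\pi_2|=|\pi_1\cap\pi_2|=|\pi_1|+|\pi_2|$. Semantics for $s,t\subseteq V$: $s\xrightarrow{p\leftarrow\top}t$ iff $t=s\cup\{p\}$; $s\xrightarrow{p\leftarrow\bot}t$ iff $t=s\setminus\{p\}$; $s\xrightarrow{\beta?}t$ iff $s=t$ and $s\vDash\beta$; $\cup,\cap$ are union and intersection of relations; $;$ is relational composition. $V'=\{p'\mid p\in V\}$ is a fresh copy, $t'=\{p'\mid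 p\in t\}$. If $V$ is ordered $p_1<p_2<\dots<p_m$, BDDs over $V\cup V'$ are reduced ordered binary decision diagrams with respect to the interleaved order $p_1<p_1'<p_2<p_2'<\dots<p_m<p_m'$; the size of a BDD is its number of nodes. *)

(* Defs.v *)
From HB Require Import structures.
From mathcomp Require Import all_boot all_order.

Set Implicit Arguments.
Unset Strict Implicit.
Unset Printing Implicit Defensive.

Inductive form (V : Type) : Type :=
| FTop
| FBot
| FAtom (p : V)
| FNeg (b : form V)
| FAnd (b1 b2 : form V).

Arguments FTop {V}.
Arguments FBot {V}.

Fixpoint form_length (V : Type) (b : form V) : nat :=
  match b with
  | FTop | FBot | FAtom _ => 1
  | FNeg b1 => (form_length b1).+1
  | FAnd b1 b2 => (form_length b1 + form_length b2).+1
  end.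

Fixpoint form_sat (V : finType) (s : {set V}) (b : form V) : bool :=
  match b with
  | FTop => true
  | FBot => false
  | FAtom p => p \in s
  | FNeg b1 => ~~ form_sat s b1
  | FAnd b1 b2 => form_sat s b1 && form_sat s b2
  end.

Inductive prog (V : Type) : Type :=
| PSet (p : V)
| PUnset (p : V)
| PTest (b : form V)
| PCup (q1 q2 : prog V)
| PSeq (q1 q2 : prog V)
| PCap (q1 q2 : prog V).

Fixpoint prog_length (V : Type) (q : prog V) : nat :=
  match q with
  | PSet _ | PUnset _ => 1
  | PTest b => form_length b
  | PCup q1 q2 | PSeq q1 q2 | PCap q1 q2 => prog_length q1 + prog_length q2
  end.

Fixpoint prog_step (V : finType) (q : prog V) (s t : {set V}) : Prop :=
  match q with
  | PSet p => t = s :|: [set p]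
  | PUnset p => t = s :\ p
  | PTest b => s = t /\ form_sat s b
  | PCup q1 q2 => prog_step q1 s t \/ prog_step q2 s t
  | PSeq q1 q2 => exists u : {set V}, prog_step q1 s u /\ prog_step q2 u t
  | PCap q1 q2 => prog_step q1 s t /\ prog_step q2 s t
  end.

(* [label u] is [inl b] on the terminal node of value [b], and
   [inr (x, lo, hi)] on a node testing [x], with successor [lo] when [x] is
   false and [hi] when [x] is true. *)
Definition bdd_child (X : Type) (N : finType)
    (label : N -> bool + X * N * N) : rel N :=
  fun u v => match label u with
             | inl _ => false
             | inr (_, lo, hi) => (v == lo) || (v == hi)
             end.

(* Reduced ordered BDDs. [bdd_unique] rules out duplicate terminals as well as
   distinct nodes with the same variable and the same successors. *)
Record bdd (d : Order.disp_t) (X : finOrderType d) : Type := Bdd {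
  bdd_node : finType;
  bdd_root : bdd_node;
  bdd_label : bdd_node -> bool + X * bdd_node * bdd_node;
  bdd_reachable : forall u, connect (bdd_child bdd_label) bdd_root u;
  bdd_ordered : forall u v x y lo hi lo' hi',
    bdd_label u = inr (x, lo, hi) -> bdd_label v = inr (y, lo', hi') ->
    bdd_child bdd_label u v -> (x < y)%O;
  bdd_irredundant : forall u x lo hi, bdd_label u = inr (x, lo, hi) -> lo != hi;
  bdd_unique : injective bdd_label
}.

Definition bdd_size (d : Order.disp_t) (X : finOrderType d) (B : bdd X) : nat :=
  #|bdd_node B|.

(* The path followed from [u] under the valuation [s] ends in terminal 1. *)
Inductive bdd_accepts (d : Order.disp_t) (X : finOrderType d) (B : bdd X)
    (s : {set X}) : bdd_node B -> Prop :=
| accepts_leaf u : bdd_label u = inl true -> bdd_accepts s u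
| accepts_node u x lo hi :
    bdd_label u = inr (x, lo, hi) ->
    bdd_accepts s (if x \in s then hi else lo) -> bdd_accepts s u.

Definition bdd_sat (d : Order.disp_t) (X : finOrderType d)
    (s : {set X}) (B : bdd X) : Prop := bdd_accepts s (bdd_root B).

(* [V] together with its primed copy: [(p, false)] is p and [(p, true)] is p'.
   The lexicographic order is the interleaved one p1 < p1' < p2 < p2' < ... *)
Notation primed_voc V := (V *l bool)%type.

Definition join_primed (d : Order.disp_t) (V : finOrderType d)
    (s t : {set V}) : {set primed_voc V} :=
  [set ((p, false) : primed_voc V) | p in s] :|:
  [set ((p, true) : primed_voc V) | p in t].

Definition translation : Type :=
  forall (d : Order.disp_t) (V : finOrderType d), prog V -> bdd (primed_voc V).

Definition correct_translation (tr : translation) : Prop :=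
  forall (d : Order.disp_t) (V : finOrderType d) (q : prog V) (s t : {set V}),
    prog_step q s t <-> bdd_sat (join_primed s t) (tr d V q).

(* Main.v *)
Require Import Defs.
From HB Require Import structures.
From mathcomp Require Import all_boot all_order all_algebra.
From mathcomp Require Import all_classical all_reals all_analysis.

Set Implicit Arguments.
Unset Strict Implicit.
Unset Printing Implicit Defensive.

(** The witness is the test [(p_0 <-> p_n) /\ ... /\ (p_(n-1) <-> p_(2n-1))],
    of length linear in [n]. In the given variable order the first half of the
    variables is read before the second, so a BDD has to remember the whole
    first half: two accepted valuations whose paths leave the first half at the
    same node could be spliced into an accepted valuation with unequal halves.
    Hence the [2 ^ n] accepted valuations leave the first half at distinct
    nodes. *)

Import Order.TTheory GRing.Theory Num.Theory.

Section FoolingSet.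

Variables (d : Order.disp_t) (X : finOrderType d) (B : bdd X) (D : pred X).
Hypothesis D_down : forall x y : X, (x <= y)%O -> D y -> D x.

Definition splice (s t : {set X}) : {set X} :=
  [set x | if D x then x \in s else x \in t].

(** Constraining the label of [u] alone suffices: [D] is an initial segment and labels increase
    along edges, so no node below [u] tests a variable of [D] either. Terminals qualify
    vacuously. *)
Definition bdd_beyond (u : bdd_node B) : Prop :=
  forall x lo hi, bdd_label u = inr (x, lo, hi) -> ~~ D x.

Lemma bdd_beyond_child (u : bdd_node B) x lo hi (b : bool) :
  bdd_label u = inr (x, lo, hi) -> ~~ D x -> bdd_beyond (if b then hi else lo).
Proof.
move=> lab_u nDx y lo' hi' lab_v; apply: contra nDx; apply: D_down.
apply/ltW/(bdd_ordered lab_u lab_v).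
by rewrite /bdd_child lab_u; case: b {lab_v}; rewrite eqxx ?orbT.
Qed.

(** Every variable tested from [u] on lies outside [D], where [splice s t] coincides with [t]. *)
Lemma bdd_accepts_beyond (u : bdd_node B) (s t : {set X}) :
  bdd_beyond u -> bdd_accepts t u -> bdd_accepts (splice s t) u.
Proof.
move=> + acc_u; elim: acc_u => {u} [u lab_u _|u x lo hi lab_u _ IH beyond_u].
  exact: accepts_leaf.
have nDx := beyond_u _ _ _ lab_u.
apply: (accepts_node lab_u); rewrite inE (negPf nDx).
by apply: IH; apply: bdd_beyond_child lab_u nDx.
Qed.

(** Take for [v] the first node on the accepting path of [s] that tests no variable of [D]. Before
    [v] only variables of [D] are tested, and there [splice s t] coincides with [s]. *)
Lemma bdd_accepts_cut (u : bdd_node B) (s : {set X}) : bdd_accepts s u ->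
  exists v : bdd_node B, [/\ bdd_beyond v, bdd_accepts s v &
    forall t, bdd_accepts (splice s t) v -> bdd_accepts (splice s t) u].
Proof.
elim=> {u} [u lab_u|u x lo hi lab_u acc_x [v [beyond_v acc_v lift_v]]].
  by exists u; split=> // [x lo hi|]; [rewrite lab_u | apply: accepts_leaf].
have [Dx|nDx] := boolP (D x).
  exists v; split=> // t /lift_v acc_t.
  by apply: (accepts_node lab_u); rewrite inE Dx.
exists u; split=> //; last exact: accepts_node lab_u acc_x.
by move=> y lo' hi'; rewrite lab_u => -[<- _ _].
Qed.

(** Sending [i] to the cut node on the path of [f i] is injective, since two indices with the same
    cut node yield an accepted splice. *)
Lemma bdd_size_fooling (I : finType) (f : I -> {set X}) :
    (forall i, bdd_sat (f i) B) ->
    (forall i j, bdd_sat (splice (f i) (f j)) B -> i = j) ->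
  #|I| <= bdd_size B.
Proof.
move=> f_sat f_fool.
have [g gP] := choice (fun i => bdd_accepts_cut (f_sat i)).
apply: (@leq_card _ _ g) => i j eq_g; apply: f_fool.
have [beyond_i _ lift_i] := gP i; apply: lift_i.
have [_ acc_j _] := gP j.
by apply: bdd_accepts_beyond => //; rewrite eq_g.
Qed.

End FoolingSet.

Definition form_iff (V : Type) (a b : Defs.form V) : Defs.form V :=
  FAnd (FNeg (FAnd a (FNeg b))) (FNeg (FAnd (FNeg a) b)).

Definition form_all (V : Type) (bs : seq (Defs.form V)) : Defs.form V :=
  foldr (@FAnd V) FTop bs.

Lemma form_sat_iff (V : finType) (s : {set V}) (a b : Defs.form V) :
  form_sat s (form_iff a b) = (form_sat s a == form_sat s b).
Proof. by rewrite /=; case: (form_sat s a); case: (form_sat s b). Qed.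

Lemma form_sat_all (V : finType) (s : {set V}) (bs : seq (Defs.form V)) :
  form_sat s (form_all bs) = all (form_sat s) bs.
Proof. by elim: bs => //= b bs ->. Qed.

Definition halves_agree (n : nat) : Defs.form 'I_(n + n) :=
  form_all [seq form_iff (FAtom (lshift n i)) (FAtom (rshift n i)) | i : 'I_n].

Definition set_halves (n : nat) (a b : {set 'I_n}) : {set 'I_(n + n)} :=
  [set i | match fintype.split i with inl k => k \in a | inr k => k \in b end].

(** Each equivalence has length 11 and is attached by one more conjunction; the closing [FTop] adds
    the final 1. *)
Lemma form_length_halves_agree (n : nat) :
  form_length (halves_agree n) = (12 * n).+1.
Proof.
rewrite /halves_agree /form_all -[n in RHS](size_enum_ord n) /image_mem.
by elim: (enum _) => //= i e ->; rewrite mulnS.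
Qed.

Lemma form_sat_halves_agree (n : nat) (a b : {set 'I_n}) :
  form_sat (set_halves a b) (halves_agree n) = (a == b).
Proof.
have agree_i i : form_sat (set_halves a b)
    (form_iff (FAtom (lshift n i)) (FAtom (rshift n i))) =
    ((i \in a) == (i \in b)).
  rewrite form_sat_iff /= !inE.
  by rewrite -[lshift n i]/(unsplit (inl i)) -[rshift n i]/(unsplit (inr i))
             !unsplitK.
rewrite form_sat_all all_map; apply/allP/eqP => [sat_ab|eq_ab i _].
  by apply/setP => i; apply/eqP; rewrite -agree_i; apply/sat_ab/mem_enum.
by apply: etrans (agree_i i) _; rewrite eq_ab eqxx.
Qed.

Lemma mem_join_primed (d : Order.disp_t) (V : finOrderType d) (s t : {set V})
    (p : V) (b : bool) :
  (((p, b) : primed_voc V) \in join_primed s t) = (p \in if b then t else s).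
Proof.
rewrite inE; apply/orP/idP => [[]/imsetP[q qs [-> ->]] //|].
by case: b => ?; [right | left]; apply/imsetP; exists p.
Qed.

(** A test relates a state only to itself, so both copies carry the same valuation; the cut keeps a
    variable and its primed copy on the same side. *)
Lemma splice_join_set_halves (n : nat) (a b : {set 'I_n}) :
  let diag c := join_primed (set_halves c c) (set_halves c c) in
  splice (fun x : primed_voc 'I_(n + n) => x.1 < n) (diag a) (diag b) =
  join_primed (set_halves a b) (set_halves a b).
Proof.
apply/setP => -[p c]; rewrite inE !mem_join_primed !if_same !inE /=.
by case: fintype.splitP.
Qed.

Lemma bdd_size_halves_agree (tr : translation) (n : nat) :
  correct_translation tr ->
  2 ^ n <= bdd_size (tr _ 'I_(n + n) (PTest (halves_agree n))).
Proof.
(* The fooling set is indexed by the [2 ^ n] subsets of ['I_n]. *)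
move=> tr_correct; rewrite -[n in 2 ^ n]card_ord -cardsT -card_powerset.
rewrite powersetT cardsT.
apply: (@bdd_size_fooling _ _ _ (fun x : primed_voc 'I_(n + n) => x.1 < n) _ _
  (fun a : {set 'I_n} => join_primed (set_halves a a) (set_halves a a))).
(* The lexicographic order compares first components first, so the cut is an initial segment. *)
- move=> [p b] [q c]; rewrite Order.ProdLexiOrder.leEprodlexi /= => /andP[le_pq _].
  exact: leq_ltn_trans le_pq.
- by move=> a; apply/tr_correct; rewrite /= form_sat_halves_agree.
- move=> a b; rewrite splice_join_set_halves => /tr_correct[_].
  by rewrite form_sat_halves_agree => /eqP.
Qed.

Local Open Scope classical_set_scope.
Local Open Scope ring_scope.

Theorem theorem13 (R : realType) (tr : translation)
    (tr_correct : correct_translation tr) :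
  exists (d : Order.disp_t) (V : nat -> finOrderType d)
         (q : forall n : nat, prog (V n)) (c : R),
    [/\ (fun n : nat => prog_length (q n)) @ \oo --> \oo,
        0 < c
      & forall n : nat, (1 <= n)%N ->
          2%:R `^ (c * (prog_length (q n))%:R)
            <= (bdd_size (tr d (V n) (q n)))%:R].
Proof.
(* The constant comes from [12 * n + 1 <= 13 * n], valid once [1 <= n]. *)
exists _, (fun n => 'I_(n + n)), (fun n => PTest (halves_agree n)), 13%:R^-1.
split=> [||n n_gt0].
- apply/cvgnyPge => m; near=> n; rewrite /= form_length_halves_agree.
  by rewrite ltnW // ltnS (leq_trans _ (leq_pmull n _)) //; near: n;
     exact: nbhs_infty_ge.
- by rewrite invr_gt0 ltr0n.
- apply: (@le_trans _ _ ((2 ^ n)%N%:R)); last first.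
    by rewrite ler_nat bdd_size_halves_agree.
  rewrite natrX -powR_mulrn ?ler0n // ler_powR ?ler1n //.
  rewrite mulrC ler_pdivrMr ?ltr0n // -natrM ler_nat.
  by rewrite /= form_length_halves_agree mulnS mulnC -add1n leq_add2r.
Unshelve. all: by end_near. Qed.
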